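(* Let $W:[0,\infty)\to\mathbb{R}^d$ be a Brownian motion with rescaled space-time Lévy area $\bar H$ and rescaled space-time-time Lévy area $\bar K$. For times $0\le s<t<u$, $$W_{s,u}=W_{s,t}+W_{t,u},$$ $$\bar H_{s,u}=\bar H_{s,t}+\bar H_{t,u}+\frac{u-s}{2}B_t^{s,u},$$ $$\bar K_{s,u}=\bar K_{s,t}+\bar K_{t,u}+\frac{u-t}{2}\bar H_{s,t}-\frac{t-s}{2}\bar H_{t,u}+\frac{(u-t)^2-(t-s)^2}{12}B_t^{s,u},$$ where $B_t^{s,u}:=W_{s,t}-\frac{t-s}{u-s}W_{s,u}$ is the Brownian bridge associated with $W$ on $[s,u]$.
   Context: For $0\le s<t$: $W_{s,t}=W_t-W_s$; $B_r^{s,t}=W_{s,r}-\frac{r-s}{t-s}W_{s,t}$ for $r\in[s,t]$; space-time Lévy area $H_{s,t}=\frac1{t-s}\int_s^tB_r^{s,t}\,dr$; space-time-time Lévy area $K_{s,t}=\frac1{(t-s)^2}\int_s^tB_r^{s,t}\left(\frac{t+s}2-r\right)dr$. Rescaled Lévy areas: $\bar H_{s,t}=(t-s)H_{s,t}$ and $\bar K_{s,t}=(t-s)^2K_{s,t}$. *)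

(* Defs.v *)
From HB Require Import structures.
From mathcomp Require Import all_boot all_order all_algebra.
From mathcomp Require Import all_classical all_reals all_analysis.

Set Implicit Arguments.
Unset Strict Implicit.
Unset Printing Implicit Defensive.

Import Order.TTheory GRing.Theory Num.Theory.
Import numFieldNormedType.Exports.

Local Open Scope classical_set_scope.
Local Open Scope ring_scope.

Section random_vectors.
Context (disp : measure_display) (T : measurableType disp) (R : realType).
Variables (P : probability T R) (d : nat).

(* The library puts no sigma-algebra on matrices: these are the Borel sets of
   the (product) topology of R^d. *)
Definition borel_vector : set (set 'rV[R]_d) := <<s [set U | open U] >>.

Definition random_vector (X : T -> 'rV[R]_d) : Prop :=
  forall A, borel_vector A -> measurable (X @^-1` A).

(* As some of the [A i] may be the whole space, the product rule over the full
   family contains the product rule over its subfamilies. *)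
Definition independent_vectors (n : nat) (X : 'I_n -> T -> 'rV[R]_d) : Prop :=
  forall A : 'I_n -> set 'rV[R]_d, (forall i, borel_vector (A i)) ->
    (P (\bigcap_(i in [set: 'I_n]) X i @^-1` A i)
     = \prod_(i < n) P (X i @^-1` A i))%E.

(* [X] has law N(0, v I_d), for v > 0; a law on R^d is determined by its values
   on boxes, and the second parameter of [normal_prob] is the standard
   deviation. *)
Definition centered_normal_vector (v : R) (X : T -> 'rV[R]_d) : Prop :=
  forall A : 'I_d -> set R, (forall j, measurable (A j)) ->
    (P (\bigcap_(j in [set: 'I_d]) [set w | A j (X w ord0 j)])
     = \prod_(j < d) normal_prob 0 (Num.sqrt v) (A j))%E.

End random_vectors.

Section brownian_motion.
Context (disp : measure_display) (T : measurableType disp) (R : realType).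
Variables (P : probability T R) (d : nat).

(* Time is [0, +oo[: the values of [W] at negative times are irrelevant. *)
Record brownian_motion (W : R -> T -> 'rV[R]_d) : Prop := BrownianMotion {
  bm_random_vector : forall t, 0 <= t -> random_vector (W t) ;
  bm_start : {ae P, forall w, W 0 w = 0} ;
  bm_independent_increments : forall (n : nat) (t : nat -> R), 0 <= t 0%N ->
    (forall i, (i < n)%N -> t i < t i.+1) ->
    independent_vectors P
      (fun (i : 'I_n) w => W (t i.+1) w - W (t i) w) ;
  bm_normal_increments : forall s t, 0 <= s -> s < t ->
    centered_normal_vector P (t - s) (fun w => W t w - W s w) ;
  bm_continuous :
    {ae P, forall w, {within `[0, +oo[, continuous (fun t => W t w)}} }.

End brownian_motion.

Section levy_areas.
Context (R : realType) (d : nat).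
Implicit Types (x : R -> 'rV[R]_d) (s t r : R).

Definition vector_integral s t x : 'rV[R]_d :=
  \row_(j < d) \int[@lebesgue_measure R]_(r in `[s, t]) x r ord0 j.

(* In the following [x] stands for a sample path of W. *)
Definition increment x s t : 'rV[R]_d := x t - x s.

Definition bridge x s t r : 'rV[R]_d :=
  increment x s r - ((r - s) / (t - s)) *: increment x s t.

Definition space_time_area x s t : 'rV[R]_d :=
  (t - s)^-1 *: vector_integral s t (bridge x s t).

Definition space_time_time_area x s t : 'rV[R]_d :=
  ((t - s) ^+ 2)^-1 *:
    vector_integral s t (fun r => ((t + s) / 2 - r) *: bridge x s t r).

Definition rescaled_space_time_area x s t : 'rV[R]_d :=
  (t - s) *: space_time_area x s t.

Definition rescaled_space_time_time_area x s t : 'rV[R]_d :=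
  (t - s) ^+ 2 *: space_time_time_area x s t.

End levy_areas.

(* Main.v *)
(* Almost every path is continuous, and for such a path the statement is
   deterministic. For a coordinate [f], write I0 and I1 for the integrals of
   [f r] and [r * f r] over [s, t]. As the bridge is [f] minus its affine
   interpolation,
     Hbar s t = I0 - (t - s) (f s + f t) / 2,
     Kbar s t = (s + t) / 2 I0 - I1 + (t - s)^2 (f t - f s) / 12.
   Since I0 and I1 are additive over adjacent intervals, both composition rules
   become rational identities in s, t, u, the values of [f] at these times and
   the moments. *)
Require Import Defs.
From HB Require Import structures.
From mathcomp Require Import all_boot all_order all_algebra.
From mathcomp Require Import all_classical all_reals all_analysis.
From mathcomp Require Import ring.

Set Implicit Arguments.
Unset Strict Implicit.
Unset Printing Implicit Defensive.

Import Order.TTheory GRing.Theory Num.Theory.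
Import numFieldNormedType.Exports.

Local Open Scope classical_set_scope.
Local Open Scope ring_scope.

Section moments.
Context {R : realType}.
Implicit Types (f : R -> R) (q : {poly R}) (s t u c : R).
Local Notation mu := (@lebesgue_measure R).

(** Polynomial parts of integrands are given through an antiderivative [q], so that their integrals
    reduce to boundary values. *)
Lemma Rintegral_deriv_poly q s t : s < t ->
  \int[mu]_(r in `[s, t]) q^`().[r] = q.[t] - q.[s].
Proof.
move=> st; rewrite /Rintegral (@continuous_FTC2 _ _ (horner q))//.
- by apply: continuous_subspaceT => r; exact: continuous_horner.
- split=> [r _||]; first exact: derivable_horner.
  + by apply: cvg_at_right_filter; exact: continuous_horner.
  + by apply: cvg_at_left_filter; exact: continuous_horner.
- by move=> r _; rewrite derivE.
Qed.

Lemma integrable_monomial_mul c n f s t : {within `[s, t], continuous f} ->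
  mu.-integrable `[s, t] (EFin \o (fun r => c * (r ^+ n * f r))).
Proof.
move=> cf; apply: continuous_compact_integrable; first exact: segment_compact.
move=> r; apply: cvgM; first exact: cvg_cst.
apply: cvgM; last exact: cf.
have /continuous_subspaceT : continuous (fun z : R => z ^+ n); last exact.
exact: exprn_continuous.
Qed.

Lemma integrable_moment n f s t : {within `[s, t], continuous f} ->
  mu.-integrable `[s, t] (EFin \o (fun r => r ^+ n * f r)).
Proof.
move=> /(integrable_monomial_mul 1 n); congr (_.-integrable _ _).
by apply/funext => r /=; rewrite mul1r.
Qed.

Definition moment n f s t := \int[mu]_(r in `[s, t]) (r ^+ n * f r).

Lemma moment_split n f s t u : s < t -> t < u ->
  {within `[s, u], continuous f} ->
  moment n f s u = moment n f s t + moment n f t u.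
Proof.
move=> st tu cf.
have intsu := integrable_moment n cf.
(* Removing [[s, t]] from [[s, u]] leaves an interval open at [t]; closing it adds only a null
   set. *)
apply/eqP; rewrite addrC -subr_eq; apply/eqP.
rewrite Rintegral_itvB ?bnd_simp ?ltW//.
rewrite Rintegral_itv_obnd_cbnd//.
apply: integrableS intsu => //.
by apply: subset_itvr; rewrite bnd_simp ltW.
Qed.

(** Common form of both areas: the bridge is a coordinate [f] plus an affine function of [r], and
    its weight is 1 or the midpoint minus [r]. Linearity then leaves two moments and a boundary
    term. *)
Lemma Rintegral_affine_weight f q a b s t : s < t ->
  {within `[s, t], continuous f} ->
  \int[mu]_(r in `[s, t]) ((a + b * r) * f r + q^`().[r]) =
  a * moment 0 f s t + b * moment 1 f s t + (q.[t] - q.[s]).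
Proof.
move=> st cf.
have intf n := integrable_moment n cf.
have intZ n c := integrable_monomial_mul c n cf.
have intq : mu.-integrable `[s, t] (EFin \o horner q^`()).
  apply: continuous_compact_integrable; first exact: segment_compact.
  by apply: continuous_subspaceT => r; exact: continuous_horner.
have intab : mu.-integrable `[s, t]
    (EFin \o (fun r => a * (r ^+ 0 * f r) + b * (r ^+ 1 * f r))).
  apply: (@integrableD _ _ _ mu) (intZ 0%N a) (intZ 1%N b).
  exact: measurable_itv.
rewrite -(Rintegral_deriv_poly q st) /moment -!RintegralZl// -RintegralD//.
rewrite -RintegralD//; apply: eq_Rintegral => r _.
by rewrite expr0 expr1; ring.
Qed.

End moments.

Section rescaled_areas.
Context {R : realType} {d : nat}.
Variables (x : R -> 'rV[R]_d) (s t : R).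
Hypothesis st : s < t.
Let f j r := x r ord0 j.
Hypothesis cf : forall j, {within `[s, t], continuous (f j)}.

Lemma rescaled_space_time_areaE :
  rescaled_space_time_area x s t =
  \row_j (moment 0 (f j) s t - (t - s) * (f j s + f j t) / 2).
Proof.
have ts0 : t - s != 0 by rewrite subr_eq0 gt_eqF.
rewrite /rescaled_space_time_area /space_time_area scalerA divff// scale1r.
apply/rowP => j; rewrite !mxE.
(* [k] is the slope of the chord, and [q] is an antiderivative of minus the chord,
   [(s * k - f j s) - k * r]. *)
pose k := (f j t - f j s) / (t - s).
pose q : {poly R} := (s * k - f j s) *: 'X - (k / 2) *: 'X^2.
transitivity (\int[@lebesgue_measure R]_(r in `[s, t])
    ((1 + 0 * r) * f j r + q^`().[r])).
  apply: eq_Rintegral => r _; rewrite /bridge /increment !mxE.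
  by rewrite /q !poly.derivE !hornerE /k /f /=; field.
rewrite Rintegral_affine_weight// /q !hornerE /k /=.
by field.
Qed.

Lemma rescaled_space_time_time_areaE :
  rescaled_space_time_time_area x s t =
  \row_j ((s + t) / 2 * moment 0 (f j) s t - moment 1 (f j) s t
           + (t - s) ^+ 2 * (f j t - f j s) / 12).
Proof.
have ts0 : t - s != 0 by rewrite subr_eq0 gt_eqF.
rewrite /rescaled_space_time_time_area /space_time_time_area scalerA.
rewrite divff ?expf_neq0// scale1r.
apply/rowP => j; rewrite !mxE.
(* Here minus the chord carries the weight [c - r]: [q] is an antiderivative of
   [(c - r) * ((s * k - f j s) - k * r)]. *)
pose k := (f j t - f j s) / (t - s); pose c := (t + s) / 2.
pose q : {poly R} := (c * (s * k - f j s)) *: 'X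
  - ((c * k + (s * k - f j s)) / 2) *: 'X^2 + (k / 3) *: 'X^3.
transitivity (\int[@lebesgue_measure R]_(r in `[s, t])
    ((c + (- 1) * r) * f j r + q^`().[r])).
  apply: eq_Rintegral => r _; rewrite /bridge /increment !mxE.
  by rewrite /q !poly.derivE !hornerE /k /c /f /=; field.
rewrite Rintegral_affine_weight// /q !hornerE /k /c /=.
by field.
Qed.

End rescaled_areas.

Theorem theorem3p3 (R : realType) (disp : measure_display)
    (T : measurableType disp) (P : probability T R) (d : nat)
    (W : R -> T -> 'rV[R]_d) (bmW : brownian_motion P W) :
  {ae P, forall w, forall s t u : R, 0 <= s -> s < t -> t < u ->
    let x := fun r => W r w in
    let Hbar := rescaled_space_time_area x in
    let Kbar := rescaled_space_time_time_area x in
    let B := bridge x s u t in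
    [/\ increment x s u = increment x s t + increment x t u,
        Hbar s u = Hbar s t + Hbar t u + ((u - s) / 2) *: B &
        Kbar s u = Kbar s t + Kbar t u + ((u - t) / 2) *: Hbar s t
                - ((t - s) / 2) *: Hbar t u
                + (((u - t) ^+ 2 - (t - s) ^+ 2) / 12) *: B]}.
Proof.
(* The exceptional null set is fixed before the times, so it serves all [s], [t], [u] at once. *)
have := bm_continuous bmW.
apply: filterS => w cW s t u s0 st tu; set x := W^~ w.
have su : s < u := lt_trans st tu.
(* Once the areas are expressed by moments, the only denominator left besides numerals is the
   [u - s] of [B]. *)
have us0 : u - s != 0 by rewrite subr_eq0 gt_eqF.
have cx j a b : 0 <= a ->
    {within `[a, b], continuous (fun r => x r ord0 j)}.
  move=> a0.
  apply: (@within_continuous_comp _ _ _ _ x (fun M : 'rV[R]_d => M ord0 j)).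
    by move=> M _; exact: coord_continuous.
  apply: continuous_subspaceW cW => z /=.
  by rewrite !in_itv/= andbT => /andP[+ _]; exact: le_trans.
have t0 : 0 <= t by exact: ltW (le_lt_trans s0 st).
split.
- by rewrite /increment [RHS]addrC addrA subrK.
- rewrite !rescaled_space_time_areaE//; do ?[by move=> j; exact: cx].
  apply/rowP => j; rewrite !mxE (moment_split _ st tu (cx j s u s0)).
  by field.
(* The rule for [Kbar] also contains [Hbar] on both subintervals; their zeroth moments absorb the
   shift between the midpoints of [[s, t]], [[t, u]] and [[s, u]]. *)
- rewrite !rescaled_space_time_areaE//; do ?[by move=> j; exact: cx].
  rewrite !rescaled_space_time_time_areaE//; do ?[by move=> j; exact: cx].
  apply/rowP => j; rewrite !mxE !(moment_split _ st tu (cx j s u s0)).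
  by field.
Qed.
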